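(* Let $P$ be a (possibly infinite) set of classical patterns and $A=\mathrm{Av}(P)$; for an integer $L$ let $A_{\le L}$ be the set of permutations in $A$ of length at most $L$. Then for any positive integers $n,m$, every mesh pattern in the output of $\mathsf{BiSC}(A_{\le n},m)$ is a classical pattern (i.e. has empty shading). Furthermore, if the longest patterns in $P$ have length $k$, then $A=\mathrm{Av}(\mathsf{BiSC}(A_{\le n},m))$ for all $n,m\ge k$.
   Context: For a word $w$ of distinct integers, $\mathrm{fl}(w)$ replaces the $i$-th smallest letter by $i$. A mesh pattern is a pair $(p,R)$ with $p$ a permutation of length $k$ and $R\subseteq\{0,\dots,k\}\times\{0,\dots,k\}$; a classical pattern $p$ is identified with $(p,\emptyset)$. An occurrence of $(p,R)$ in a permutation $\pi$ of length $n$ is a sequence $1\le j_1<\dots<j_k\le n$ with $\mathrm{fl}(\pi_{j_1}\cdots\pi_{j_k})=p$ such that, with $j_0=0$, $j_{k+1}=n+1$ and $v_0<\dots<v_{k+1}$ being $0$, the sorted values $\pi_{j_i}$, and $n+1$, for each $(a,b)\in R$ no index $x$ satisfies $j_a<x<j_{a+1}$ and $v_b<\pi_x<v_{b+1}$. $\pi$ contains $(p,R)$ if an occurrence exists; $\mathrm{Av}(M)$ is the set of permutations avoiding all patterns in $M$. The maximal shading of an occurrence of $p$ in $\pi$ is the set of all boxes $(a,b)$ with no such point $x$. $\mathsf{Mine}(B,m)$, for a finite set $B$ of permutations: for each classical pattern $p$ of length at most $m$ output $(p,\mathrm{sh}_p)$, where $\mathrm{sh}_p$ is the set of inclusion-maximal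 elements among the maximal shadings of all occurrences of $p$ in permutations of $B$ (empty if $p$ occurs in none). $\mathsf{Forb}(S)$: for each $(p,\mathrm{sh}_p)\in S$ (processed in order of increasing length of $p$), let $\mathrm{forb}_p$ be the set of inclusion-minimal subsets $R\subseteq\{0,\dots,k\}^2$ not contained in any member of $\mathrm{sh}_p$; then remove from $\mathrm{forb}_p$ every $R$ for which there are a classical pattern $q$ properly contained in $p$, processed earlier, and $R'\in\mathrm{forb}_q$ such that every permutation containing $(p,R)$ also contains $(q,R')$. The output is the set of mesh patterns $(p,R)$ with $R\in\mathrm{forb}_p$. $\mathsf{BiSC}(B,m)=\mathsf{Forb}(\mathsf{Mine}(B,m))$.
   Formalization: The second claim is proved under the added hypothesis that A_{≤m} is contained in A_{≤n} (automatic if m ≤ n); without it the claim fails, e.g. P={21}, n=2, m=3, where 123 in A is output as a forbidden pattern. *)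

(* Defs.v *)
From mathcomp Require Import all_boot.
From mathcomp Require Import boolp classical_sets.

Set Implicit Arguments.
Unset Strict Implicit.
Unset Printing Implicit Defensive.

Local Open Scope classical_set_scope.

(* Permutations of arbitrary length in one-line notation, letters 1, ..., n;
   the empty word is a permutation, hence also a pattern of length 0. *)
Record permutation := Permutation {
  word :> seq nat;
  word_perm : perm_eq word (iota 1 (size word))
}.

(* The i-th smallest letter of a word w with distinct letters is the one with
   exactly i letters <= it in w. *)
Definition fl (w : seq nat) : seq nat :=
  [seq count (fun y => y <= x) w | x <- w].

(* pi_x, with positions counted from 1. *)
Definition letter (pi : permutation) (x : nat) : nat := nth 0 pi x.-1.

Definition letters_at (pi : permutation) (js : seq nat) : seq nat :=
  [seq letter pi j | j <- js].

Definition occurrence (p pi : permutation) (js : seq nat) : bool :=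
  [&& sorted ltn js, all (fun j => 1 <= j <= size pi) js
    & fl (letters_at pi js) == p].

Definition box (p : permutation) : finType :=
  ('I_(size p).+1 * 'I_(size p).+1)%type.

Record mesh_pattern := Mesh { pattern : permutation; shading : {set box pattern} }.

Definition classical (p : permutation) : mesh_pattern := @Mesh p finset.set0.

(* j_a, with j_0 = 0 and j_(k+1) = n + 1. *)
Definition position_bound (pi : permutation) (js : seq nat) (a : nat) : nat :=
  nth 0 (0 :: rcons js (size pi).+1) a.

(* v_b, with v_0 = 0 and v_(k+1) = n + 1. *)
Definition value_bound (pi : permutation) (js : seq nat) (b : nat) : nat :=
  nth 0 (0 :: rcons (sort leq (letters_at pi js)) (size pi).+1) b.

Definition box_empty (pi : permutation) (js : seq nat) (a b : nat) : bool :=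
  ~~ has (fun x =>
            (position_bound pi js a < x < position_bound pi js a.+1)
            && (value_bound pi js b < letter pi x < value_bound pi js b.+1))
         (iota 1 (size pi)).

Definition mesh_occurrence (M : mesh_pattern) (pi : permutation)
    (js : seq nat) : bool :=
  occurrence (pattern M) pi js
  && [forall c in shading M, box_empty pi js c.1 c.2].

Definition contains (pi : permutation) (M : mesh_pattern) : Prop :=
  exists js, mesh_occurrence M pi js.

Definition Av (Ms : set mesh_pattern) : set permutation :=
  [set pi | forall M, Ms M -> ~ contains pi M].

Definition upto (L : nat) (A : set permutation) : set permutation :=
  [set pi | A pi /\ size pi <= L].

Definition maximal_shading (p pi : permutation) (js : seq nat) : {set box p} :=
  finset (fun c : box p => box_empty pi js c.1 c.2).

Definition is_maximal_shading (B : set permutation) (p : permutation)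
    (X : {set box p}) : Prop :=
  exists pi js, [/\ B pi, occurrence p pi js & X = maximal_shading p pi js].

Record mined := Mined {
  mined_pattern : permutation;
  mined_shadings : {set {set box mined_pattern}}
}.

Definition sh (B : set permutation) (p : permutation) : {set {set box p}} :=
  finset (maxset (fun X : {set box p} => `[< is_maximal_shading B X >])).

Definition Mine (B : set permutation) (m : nat) : set mined :=
  [set s | exists2 p : permutation, size p <= m & s = Mined (sh B p)].

Definition minimal_forbidden (p : permutation) (Xs : {set {set box p}})
    (R : {set box p}) : bool :=
  minset (fun R' : {set box p} => [forall X in Xs, ~~ (R' \subset X)]) R.

Definition properly_contained (q p : permutation) : Prop :=
  q <> p /\ contains p (classical q).

Definition redundant (earlier : set mesh_pattern) (M : mesh_pattern) : Prop :=
  exists N, [/\ earlier N, properly_contained (pattern N) (pattern M)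
              & forall pi, contains pi M -> contains pi N].

(* The mesh patterns retained once all entries of length < l are processed.
   Entries of equal length do not interact, since a proper containment of
   patterns strictly increases the length. *)
Fixpoint forb_below (S : set mined) (l : nat) : set mesh_pattern :=
  if l is l'.+1 then
    forb_below S l' `|`
    [set M | exists (s : mined) (R : {set box (mined_pattern s)}),
       [/\ S s, size (mined_pattern s) = l',
           minimal_forbidden (mined_shadings s) R,
           M = Mesh R & ~ redundant (forb_below S l') M]]
  else set0.

Definition Forb (S : set mined) : set mesh_pattern :=
  [set M | exists l, forb_below S l M].

Definition BiSC (B : set permutation) (m : nat) : set mesh_pattern :=
  Forb (Mine B m).

(* Main.v *)
Require Import Defs.
From mathcomp Require Import all_boot.
From mathcomp Require Import boolp classical_sets.

Local Open Scope classical_set_scope.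

(** Let [B] be the set of members of [A] of length at most [n].  Since [A] is
    closed under taking classical patterns, a pattern [p] occurring in a member
    of [B] is itself in [B].  The occurrence of [p] in itself has the full
    maximal shading, so then no shading of [p] is forbidden.  If [p] occurs
    nowhere in [B], the only minimal forbidden shading is the empty one.  Hence
    the output consists of classical patterns [p] outside [B]; a pattern removed
    as redundant is replaced by an output pattern forbidding at least as much. *)

(** If [z < y], the letter [y] is itself counted on the left but not on the right. Hence passing
    from letters of [w] to their ranks preserves order. *)
Lemma count_leq_mono (w : seq nat) (y z : nat) :
  y \in w ->
  (count (fun x => x <= y) w <= count (fun x => x <= z) w) = (y <= z).
Proof.
move=> yw; case: (leqP y z) => [yz|zy].
  by apply: sub_count => x /= xy; apply: leq_trans yz.
apply/negbTE; rewrite -ltnNge.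
rewrite (@eq_count _ (fun x => x <= y)
          (predU (fun x => x <= z) (fun x => z < x <= y))); last first.
  move=> x /=; case: (leqP x z) => // xz.
  by rewrite (leq_trans xz (ltnW zy)).
have : 0 < count (fun x => z < x <= y) w.
  by rewrite -has_count; apply/hasP; exists y => //; rewrite zy leqnn.
rewrite -(ltn_add2l (count (fun x => x <= z) w)) addn0 -count_predUI.
rewrite (@eq_count _ (predI _ _) pred0) ?count_pred0 ?addn0 // => x /=.
by case: (leqP x z).
Qed.

Lemma fl_map_mono (f : nat -> nat) (w : seq nat) :
  {in w &, forall y z, (f y <= f z) = (y <= z)} -> fl (map f w) = fl w.
Proof.
move=> fmono; rewrite /fl -map_comp; apply/eq_in_map => x xw /=.
by rewrite count_map; apply: eq_in_count => y yw; apply: fmono.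
Qed.

(** Exactly [x] of the letters 1, ..., n are at most [x]: split the range at [x]. *)
Lemma fl_permutation (p : permutation) : fl p = p.
Proof.
have pp := word_perm p.
rewrite /fl -[RHS]map_id; apply/eq_in_map => x.
rewrite (perm_mem pp) mem_iota add1n ltnS => /andP[x_gt0 xn].
rewrite (permP pp) -(subnKC xn) iotaD count_cat.
rewrite (@eq_in_count _ _ predT (iota 1 x)); last first.
  by move=> y; rewrite mem_iota add1n ltnS => /andP[].
rewrite count_predT size_iota (@eq_in_count _ _ pred0); last first.
  by move=> y; rewrite mem_iota add1n => /andP[xy _] /=; rewrite leqNgt xy.
by rewrite count_pred0 addn0.
Qed.

Lemma occurrence_size (p pi : permutation) (js : seq nat) :
  occurrence p pi js -> size js = size p.
Proof. by case/and3P=> _ _ /eqP <-; rewrite !size_map. Qed.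

Lemma occurrence_leq_size (p pi : permutation) (js : seq nat) :
  occurrence p pi js -> size p <= size pi.
Proof.
move=> occ; rewrite -(occurrence_size _ _ _ occ).
case/and3P: occ => js_sorted js_in _.
rewrite -(size_iota 1 (size pi)); apply: uniq_leq_size.
  exact: sorted_uniq ltn_trans ltnn _ js_sorted.
by move=> j /(allP js_in); rewrite mem_iota add1n ltnS.
Qed.

Lemma occurrence_refl (p : permutation) : occurrence p p (iota 1 (size p)).
Proof.
apply/and3P; split; first exact: iota_ltn_sorted.
  by apply/allP => j; rewrite mem_iota add1n ltnS.
rewrite -[X in _ == X]fl_permutation /letters_at; apply/eqP; congr fl.
rewrite (iotaDl 1 0) -map_comp; exact: mkseq_nth.
Qed.

(** Transitivity of classical containment: [ks] selects entries of [js]. Positions start at 1 and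
    [nth] at 0, hence [i.-1]. *)
Lemma occurrence_trans (q p pi : permutation) (ks js : seq nat) :
  occurrence q p ks -> occurrence p pi js ->
  occurrence q pi [seq nth 0 js i.-1 | i <- ks].
Proof.
move=> occ_q occ_p; have size_js := occurrence_size _ _ _ occ_p.
case/and3P: occ_q => ks_sorted /allP ks_in /eqP fl_q.
case/and3P: occ_p => js_sorted /allP js_in /eqP fl_p.
have ks_bound i : i \in ks -> i.-1 < size js.
  by move=> /ks_in; rewrite size_js; case: i.
apply/and3P; split.
- rewrite sorted_map; have/allP ks_all := ks_in.
  apply: (sub_in_sorted _ ks_all ks_sorted) => i j.
  move=> /andP[i_gt0 ip] /andP[j_gt0 jp] ij /=.
  apply: (sorted_ltn_nth ltn_trans 0 js_sorted); rewrite ?inE ?size_js.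
  + by case: i i_gt0 ip {ij}.
  + by case: j j_gt0 jp {ij}.
  + by case: i i_gt0 ij {ip} => // i _; case: j {jp} j_gt0.
- by apply/allP => _ /mapP[i ii ->]; apply/js_in/mem_nth/ks_bound.
- apply/eqP; rewrite -fl_q /letters_at -map_comp.
  set w := letters_at pi js in fl_p.
  (* As [p] is [fl w], its letters are ranks in [w] of letters of [pi]; ranking is monotone there,
     so [fl] does not see it. *)
  have -> : [seq letter p i | i <- ks]
      = [seq count (fun y => y <= x) w
           | x <- [seq letter pi (nth 0 js i.-1) | i <- ks]].
    rewrite -map_comp; apply/eq_in_map => i /ks_bound ib /=.
    by rewrite {1}/letter -fl_p !(nth_map 0) ?size_map.
  apply/esym/fl_map_mono => y z /mapP[i /ks_bound ib ->] _.
  by apply: count_leq_mono; apply/map_f/mem_nth.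
Qed.

Lemma contains_classicalP (p pi : permutation) :
  contains pi (classical p) <-> exists js, occurrence p pi js.
Proof.
split=> [[js /andP[occ _]]|[js occ]]; exists js => //.
by rewrite /mesh_occurrence occ; apply/forall_inP => c; rewrite finset.in_set0.
Qed.

Lemma Av_classical_closed {P : set permutation} {p pi : permutation}
    {js : seq nat} :
  Av (classical @` P) pi -> occurrence p pi js -> Av (classical @` P) p.
Proof.
move=> avpi occ _ [q Pq <-] /contains_classicalP[ks occ_q].
apply: (avpi (classical q)); first by exists q.
by apply/contains_classicalP; eexists; apply: occurrence_trans occ_q occ.
Qed.

Lemma maximal_shading_refl (p : permutation) :
  maximal_shading p p (iota 1 (size p)) = finset.setT.
Proof.
apply/setP => -[a b]; rewrite !inE /=; apply/hasPn => x _.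
(* When all positions are selected, column [a] is the open interval from [a] to [a.+1], which
   contains no integer. *)
have boundE i : i < (size p).+2 ->
    position_bound p (iota 1 (size p)) i = i.
  move=> ip; rewrite /position_bound.
  have -> : 0 :: rcons (iota 1 (size p)) (size p).+1 = iota 0 (size p).+2.
    by rewrite -cats1 -[(size p).+2]addn1 iotaD.
  by rewrite nth_iota.
rewrite !boundE; last 2 first.
- by rewrite ltnS ltn_ord.
- by rewrite ltnS ltnW // ltn_ord.
by rewrite ltnS; case: leqP.
Qed.

Lemma minimal_forbidden_mem (B : set permutation) (p : permutation)
    (R : {set box p}) :
  B p -> ~~ minimal_forbidden (sh B p) R.
Proof.
move=> Bp; apply/negP => /minsetp /forall_inP /(_ finset.setT) setT_out.
suff /setT_out : finset.setT \in sh B p by rewrite finset.subsetT.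
rewrite inE; apply/maxsetP; split=> [|X _]; last by rewrite finset.subTset => /eqP.
apply/asboolP; exists p, (iota 1 (size p)).
by split=> //; [exact: occurrence_refl | rewrite maximal_shading_refl].
Qed.

Lemma sh_no_occurrence (B : set permutation) (p : permutation) :
  (forall pi js, B pi -> ~~ occurrence p pi js) -> sh B p = finset.set0.
Proof.
move=> nocc; apply/setP => X; rewrite !inE.
apply/negP => /maxsetp /asboolP[pi [js [Bpi occ _]]].
by move: (nocc pi js Bpi); rewrite occ.
Qed.

(** With no shading to escape, every set qualifies vacuously, so the minimum is the empty one. *)
Lemma minimal_forbidden_set0 (p : permutation) (R : {set box p}) :
  minimal_forbidden finset.set0 R = (R == finset.set0).
Proof.
have all_forbidden (Q : {set box p}) :
    [forall X in (finset.set0 : {set {set box p}}), ~~ (Q \subset X)].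
  by apply/forall_inP => X; rewrite finset.in_set0.
apply/idP/eqP => [/minsetP[_ minR]|->].
  by apply/esym/minR => //; rewrite finset.sub0set.
by apply/minsetP; split=> // Q _; rewrite finset.subset0 => /eqP.
Qed.

Lemma sh_upto_Av (P : set permutation) (n : nat) (p : permutation) :
  ~ upto n (Av (classical @` P)) p ->
  sh (upto n (Av (classical @` P))) p = finset.set0.
Proof.
move=> nBp; apply: sh_no_occurrence => pi js [avpi pin].
apply/negP => occ; apply: nBp; split; first exact: Av_classical_closed avpi occ.
exact: leq_trans (occurrence_leq_size _ _ _ occ) pin.
Qed.

Lemma BiSC_upto_Av (P : set permutation) (n m : nat) (M : mesh_pattern) :
  BiSC (upto n (Av (classical @` P))) m M ->
  exists p : permutation, [/\ size p <= m, ~ upto n (Av (classical @` P)) p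
              & M = classical p].
Proof.
case=> l; elim: l => [//|l IHl] /= [/IHl //|].
move=> [s [R [[p pm s_p]]]]; subst s => _ /= minR -> _.
have nBp : ~ upto n (Av (classical @` P)) p.
  by move=> /(minimal_forbidden_mem _ _ R) /negP; apply.
exists p; split=> //.
by move: minR; rewrite (sh_upto_Av _ _ _ nBp) minimal_forbidden_set0 => /eqP ->.
Qed.

Lemma contains_BiSC (P : set permutation) (n m : nat) (p pi : permutation) :
  size p <= m -> ~ upto n (Av (classical @` P)) p -> contains pi (classical p) ->
  exists2 M, BiSC (upto n (Av (classical @` P))) m M & contains pi M.
Proof.
move=> pm nBp pi_p; set B := upto _ _.
(* If [classical p] is removed, the retained [N] responsible for it also occurs in [pi]. Otherwise
   [classical p] itself is output, entering at stage [(size p).+1], which processes length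
   [size p]. *)
have [[N [earlyN _ impl]]|nred] :=
    pselect (redundant (forb_below (Mine B m) (size p)) (classical p)).
  by exists N; [exists (size p) | apply: impl].
exists (classical p) => //; exists (size p).+1; right.
exists (Mined (sh B p)), finset.set0; split=> //; first by exists p.
by rewrite /= sh_upto_Av // minimal_forbidden_set0.
Qed.

Theorem theorem2p4 (P A : set permutation)
    (A_def : A = Av (classical @` P)) :
  (forall n m : nat, 0 < n -> 0 < m ->
     forall M : mesh_pattern, BiSC (upto n A) m M -> shading M = finset.set0)
  /\
  (forall k : nat,
     (exists2 p, P p & size p = k) -> (forall p, P p -> size p <= k) ->
     forall n m : nat, k <= n -> k <= m ->
       (* no member of A has length in (n, m]; automatic when m <= n,
          and necessary for the equality *)
       upto m A `<=` upto n A ->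
       A = Av (BiSC (upto n A) m)).
Proof.
subst A; split=> [n m _ _ M /BiSC_upto_Av[p [_ _ ->]] //|].
move=> k _ Pk n m kn km Amn; apply/seteqP; split=> pi.
  (* An output pattern [p] occurring in [pi] would lie in the class by closure and have length at
     most [m]; [Amn] then bounds its length by [n], contradicting [nBp]. *)
  move=> Api _ /BiSC_upto_Av[p [pm nBp ->]] /contains_classicalP[js occ].
  by apply/nBp/Amn; split=> //; apply: Av_classical_closed Api occ.
move=> avpi _ [p Pp <-] pi_p.
(* A basis pattern contains itself, so it lies outside the class; its length is at most [k], hence
   at most [m], so it is among the patterns mined. *)
have nBp : ~ upto n (Av (classical @` P)) p.
  case=> /(_ (classical p)) + _; apply; first by exists p.
  by apply/contains_classicalP; eexists; apply: occurrence_refl.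
have [M outM pi_M] := contains_BiSC _ _ _ _ _ (leq_trans (Pk p Pp) km) nBp pi_p.
exact: avpi outM pi_M.
Qed.
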